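(* Let $\mu\ge0$ and $c<\infty$. Assume that for the fixed data distribution $P_x$ there are $\beta_n\ge0$ with $\Pi_n=\sigma_n^{4\mu}\beta_n$ for all $n\in\mathbb N$, and that for every noise distribution $P_\varepsilon\in\Psi$ there are $\gamma_n\ge0$ (possibly depending on $P_\varepsilon$) with $\Delta_n(P_\varepsilon)=\boldsymbol\delta(P_\varepsilon)^2\gamma_n$ for all $n\in\mathbb N$ and $$\sum_{n\in\mathbb N}\beta_n^{\frac1{1+2\mu}}\gamma_n^{\frac{2\mu}{1+2\mu}}\le c .$$ Then there is a constant $C'<\infty$, independent of $\delta$, such that for all $\delta>0$ $$\sup\Big\{\mathbb E_{x\sim P_x,\varepsilon\sim P_\varepsilon}\big[\|A^\dagger Ax-R^{\mathrm{MSE}}_{P_\varepsilon}(Ax+\varepsilon)\|^2\big]\ \Big|\ P_\varepsilon\in\Psi,\ \boldsymbol\delta(P_\varepsilon)\le\delta\Big\}\le C'\,\delta^{2\frac{2\mu}{1+2\mu}}.$$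
   Context: $X,Y$ are real Hilbert spaces and $A:X\to Y$ is a compact linear operator with infinite-dimensional range and singular value expansion $Ax=\sum_{n\in\mathbb N}\sigma_n\langle x,u_n\rangle v_n$, where $\sigma_n>0$, $(u_n)$ is an orthonormal basis of $\mathcal N(A)^\perp$ and $(v_n)$ is an orthonormal basis of $\overline{\mathcal R(A)}$; $\mathbb N=\{1,2,\dots\}$. $A^\dagger$ is the pseudo-inverse, so $A^\dagger A$ is the orthogonal projection onto $\mathcal N(A)^\perp$. $P_x$ is a fixed probability distribution on $X$ with $\mathbb E_{x\sim P_x}[\|x\|^2]<\infty$. $\Psi$ is a family of noise distributions $P_\varepsilon$. The noise $\varepsilon\sim P_\varepsilon$ is independent of $x$, has zero mean, and enters only through its coefficients $\langle\varepsilon,v_n\rangle$, which are zero-mean square-integrable real random variables (so white noise, which is not $Y$-valued, is allowed). $\Pi_n=\mathbb E_{x\sim P_x}[\langle x,u_n\rangle^2]$ and $\Delta_n=\Delta_n(P_\varepsilon)=\mathbb E_{\varepsilon\sim P_\varepsilon}[\langle\varepsilon,v_n\rangle^2]$. The noise level is $\boldsymbol\delta(P_\varepsilon)=\sqrt{\sup_{n}\Delta_n(P_\varepsilon)}$. For a real sequence $g$, $R[g](y)=\sum_n g_n\langle y,v_n\rangle u_n$; in particular $R[g](Ax+\varepsilon)=\sum_n g_n(\sigma_n\langle x,u_n\rangle+\langle\varepsilon,v_n\rangle)u_n$. The learned operator is $R^{\mathrm{MSE}}_{P_\varepsilon}=R[g^{\mathrm{MSE}}_{P_\varepsilon,P_x}]$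 with $(g^{\mathrm{MSE}}_{P_\varepsilon,P_x})_n=\frac{\sigma_n\Pi_n}{\Pi_n\sigma_n^2+\Delta_n}$ (convention $0/0=0$), which minimizes $g\mapsto\mathbb E_{x,\varepsilon}[\|R[g](Ax+\varepsilon)-x\|^2]$. Conventions: $0^0=1$; the supremum over the empty set is $0$. *)

(* Defs.v *)
From HB Require Import structures.
From mathcomp Require Import all_boot all_order all_algebra.
From mathcomp Require Import all_classical all_reals all_analysis.

Set Implicit Arguments.
Unset Strict Implicit.
Unset Printing Implicit Defensive.

Import Order.TTheory GRing.Theory Num.Theory.
Import numFieldNormedType.Exports.

Local Open Scope classical_set_scope.
Local Open Scope ring_scope.

(** A real Hilbert space is a complete normed module [V] together with a
    positive definite symmetric bilinear form [ip] inducing its norm. *)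
Definition induces_norm (R : realType) (V : completeNormedModType R)
    (ip : {dot V for idfun}) : Prop :=
  forall x : V, `|x| ^+ 2 = ip x x.

Definition ortho_compl (R : realType) (V : completeNormedModType R)
    (ip : {dot V for idfun}) (S : set V) : set V :=
  [set x | forall z, S z -> ip x z = 0].

Definition lin_span (R : realType) (V : completeNormedModType R) (I : Type)
    (e : I -> V) : set V :=
  [set x | exists (n : nat) (k : 'I_n -> I) (c : 'I_n -> R),
             x = \sum_(i < n) c i *: e (k i)].

(** The sequence [e] is an orthonormal basis of the closed subspace [S]. *)
Definition orthonormal_basis (R : realType) (V : completeNormedModType R)
    (ip : {dot V for idfun}) (e : nat -> V) (S : set V) : Prop :=
  (forall i j : nat, ip (e i) (e j) = (i == j)%:R) /\ closure (lin_span e) = S.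

Definition compact_operator (R : realType) (X Y : completeNormedModType R)
    (A : {linear X -> Y}) : Prop :=
  forall B : set X, bounded_set B -> precompact (A @` B).

Definition infinite_dim_range (R : realType) (X Y : completeNormedModType R)
    (A : {linear X -> Y}) : Prop :=
  forall (n : nat) (w : 'I_n -> Y), ~ (range A `<=` lin_span w).

(** Indices start at 0 instead of 1. *)
Definition singular_system (R : realType) (X Y : completeNormedModType R)
    (ipX : {dot X for idfun}) (ipY : {dot Y for idfun}) (A : {linear X -> Y})
    (sigma : nat -> R) (u : nat -> X) (v : nat -> Y) : Prop :=
  [/\ forall n, 0 < sigma n,
      orthonormal_basis ipX u (ortho_compl ipX (A @^-1` [set 0])),
      orthonormal_basis ipY v (closure (range A)) &
      forall x : X,
        series (fun n => (sigma n * ipX x (u n)) *: v n) @ \oo --> A x].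

Definition least_squares (R : realType) (X Y : completeNormedModType R)
    (A : {linear X -> Y}) (y : Y) : set X :=
  [set x | forall z : X, `|A x - y| <= `|A z - y|].

(** Moore-Penrose inverse: the least-squares solution of minimal norm
    (unique when it exists, i.e. when [y] is in the domain
    R(A) + R(A)^_|_, and set to 0 for the other [y]). *)
Definition moore_penrose (R : realType) (X Y : completeNormedModType R)
    (A : {linear X -> Y}) (y : Y) : X :=
  xget 0 [set x | least_squares A y x /\
                  forall z, least_squares A y z -> `|x| <= `|z|].

(** [V] with its Borel sigma-algebra. *)
Definition borel_space (R : realType) (V : completeNormedModType R) :=
  g_sigma_algebraType (@open V).

(** The space of real sequences with its product sigma-algebra. A noise
    distribution is represented by the joint law, on this space, of the
    coefficients <eps, v_n>; the noise itself need not be [Y]-valued. *)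
Definition cylinders (R : realType) : set (set (nat -> R)) :=
  [set C | exists (n : nat) (B : set R),
             measurable B /\ C = [set e | B (e n)]].

Definition noise_space (R : realType) := g_sigma_algebraType (@cylinders R).

Definition coef (R : realType) (n : nat) (e : noise_space R) : R := e n.

Definition centered_square_integrable (R : realType)
    (P : probability (noise_space R) R) : Prop :=
  forall n : nat, coef n \in Lfun P 2%:E /\ ('E_P[coef n] = 0)%E.

Section MSE.
Local Open Scope ereal_scope.
Variable R : realType.

(** Pi_n *)
Definition data_var (X : completeNormedModType R) (ipX : {dot X for idfun})
    (u : nat -> X) (Px : probability (borel_space X) R) (n : nat) : \bar R :=
  'E_Px[fun x => (ipX x (u n) ^+ 2)%R].

(** Delta_n *)
Definition noise_var (Pe : probability (noise_space R) R) (n : nat) : \bar R :=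
  'E_Pe[fun e => (coef n e ^+ 2)%R].

(** Extended real-valued, since the variances need not be bounded in [n]. *)
Definition noise_level (Pe : probability (noise_space R) R) : \bar R :=
  sqrte (ereal_sup (range (noise_var Pe))).

(** [filter_reconstruct u g y] is R[g](y), where the data [y] are given by
    their coefficients [y n] = <y, v_n>. The value of [lim] is only meaningful
    for those [y] for which the series converges in [X]. *)
Definition filter_reconstruct (X : completeNormedModType R) (u : nat -> X)
    (g y : nat -> R) : X :=
  lim (series (fun n => (g n * y n) *: u n)%R @ \oo).

(** [0 / 0 = 0] by the convention of the library. *)
Definition mse_filter (X : completeNormedModType R) (ipX : {dot X for idfun})
    (sigma : nat -> R) (u : nat -> X) (Px : probability (borel_space X) R)
    (Pe : probability (noise_space R) R) (n : nat) : R :=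
  let Pi := fine (data_var ipX u Px n) in
  let Delta := fine (noise_var Pe n) in
  (sigma n * Pi / (Pi * sigma n ^+ 2 + Delta))%R.

(** E |A^dagger A x - R^MSE(A x + eps)|^2; independence of x and eps is the
    product measure. *)
Definition mse (X Y : completeNormedModType R)
    (ipX : {dot X for idfun}) (ipY : {dot Y for idfun}) (A : {linear X -> Y})
    (sigma : nat -> R) (u : nat -> X) (v : nat -> Y)
    (Px : probability (borel_space X) R)
    (Pe : probability (noise_space R) R) : \bar R :=
  let Rmse := filter_reconstruct u (mse_filter ipX sigma u Px Pe) in
  \int[Px \x Pe]_w
    (`|moore_penrose A (A w.1)
       - Rmse (fun n => ipY (A w.1) (v n) + coef n w.2)| ^+ 2)%:E.

(** Supremum of a set of nonnegative quantities, with sup of the empty set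
    equal to 0 ([ereal_sup set0] is -oo). *)
Definition nonneg_sup (S : set (\bar R)) : \bar R :=
  if S == set0 then 0 else ereal_sup S.

End MSE.

(* Main.v *)
Require Import Defs.
From HB Require Import structures.
From mathcomp Require Import all_boot all_order all_algebra.
From mathcomp Require Import all_classical all_reals all_analysis.
From mathcomp Require Import measurable_realfun ring lra.
Import Order.TTheory GRing.Theory Num.Theory.
Import numFieldNormedType.Exports.
Local Open Scope classical_set_scope.
Local Open Scope ring_scope.

(** The error [A^dagger A x - R(A x + eps)] has coefficients
    [(1 - g_n sigma_n) <x, u_n> - g_n <eps, v_n>] in the orthonormal system
    [u], so by Parseval and [(a - b)^2 <= 2 a^2 + 2 b^2] its mean square is at
    most twice the sum of [(1 - g_n sigma_n)^2 Pi_n + g_n^2 Delta_n], which for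
    the MSE filter equals [Pi_n Delta_n / (Pi_n sigma_n^2 + Delta_n)]. With
    [theta = 2 mu / (1 + 2 mu)], the weighted inequality
    [a^theta b^(1 - theta) <= a + b] applied to the denominator bounds this
    term by [beta_n^(1 - theta) Delta_n^theta], and
    [Delta_n^theta <= delta^(2 theta) gamma_n^theta]. Losing the factor 2
    avoids the cross term, hence any use of independence beyond Fubini for
    functions of one variable. *)

(** * Orthonormal series in a Hilbert space *)

Section Hilbert.
Variables (R : realType) (X : completeNormedModType R) (ip : {dot X for idfun}).
Hypothesis hX : induces_norm ip.

Lemma ip_sym (x y : X) : ip x y = ip y x.
Proof. by rewrite hermC expr0 mul1r. Qed.

Lemma sqr_normD (x y : X) : `|x + y| ^+ 2 = `|x| ^+ 2 + 2 * ip x y + `|y| ^+ 2.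
Proof. by rewrite !hX linearDl !linearDr /= (ip_sym y x); ring. Qed.

Lemma sqr_normB (x y : X) : `|x - y| ^+ 2 = `|x| ^+ 2 - 2 * ip x y + `|y| ^+ 2.
Proof. by rewrite sqr_normD linearNr normrN mulrN. Qed.

(** Reduces continuity of the inner product to continuity of the norm. *)
Lemma ip_polarization (x y : X) : ip x y = (`|x + y| ^+ 2 - `|x - y| ^+ 2) / 4.
Proof. by rewrite sqr_normD sqr_normB; field. Qed.

Lemma continuous_ip (y : X) : continuous (ip^~ y).
Proof.
move=> x; rewrite (_ : ip^~ y = fun z => (`|z + y| ^+ 2 - `|z - y| ^+ 2) / 4); last first.
  by apply/funext => z; exact: ip_polarization.
apply: cvgM; last exact: cvg_cst.
have H (w : X) : `|z + w| ^+ 2 @[z --> x] --> `|x + w| ^+ 2.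
  rewrite expr2; under eq_fun do rewrite expr2.
  by apply: cvgM; apply: cvg_norm; apply: cvgD => //; exact: cvg_cst.
by apply: cvgB.
Qed.

Variable e : nat -> X.
Hypothesis e_ortho : forall i j : nat, ip (e i) (e j) = (i == j)%:R.

Lemma ip_sum_ortho (r : seq nat) (c : nat -> R) (k : nat) : uniq r ->
  ip (\sum_(i <- r) c i *: e i) (e k) = if k \in r then c k else 0.
Proof.
move=> ru; rewrite linear_sumlz.
under eq_bigr do rewrite linearZl_LR /= e_ortho.
case: ifPn => kr.
  rewrite (bigD1_seq k)//= eqxx mulr1 big1 ?addr0// => i /negPf ->.
  by rewrite mulr0.
rewrite big_seq big1// => i ir; case: eqP => [ik|_]; last by rewrite mulr0.
by rewrite -ik ir in kr.
Qed.

(** Pythagoras over any duplicate-free list of indices, which covers both the partial sums and the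
    blocks of the Cauchy criterion. *)
Lemma sqr_norm_sum_ortho (r : seq nat) (c : nat -> R) : uniq r ->
  `|\sum_(i <- r) c i *: e i| ^+ 2 = \sum_(i <- r) c i ^+ 2.
Proof.
move=> ru; rewrite hX linear_sumr big_seq [RHS]big_seq.
apply: eq_bigr => i ir.
by rewrite linearZr_LR /= ip_sum_ortho// ir expr2.
Qed.

Lemma bessel (x : X) (n : nat) : series (fun k => ip x (e k) ^+ 2) n <= `|x| ^+ 2.
Proof.
rewrite /series /=; set p := \sum_(0 <= k < n) ip x (e k) *: e k.
have pE : `|p| ^+ 2 = \sum_(0 <= k < n) ip x (e k) ^+ 2.
  by rewrite sqr_norm_sum_ortho// iota_uniq.
have xp : ip x p = `|p| ^+ 2.
  rewrite {1}/p linear_sumr pE; apply: eq_bigr => i _.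
  by rewrite linearZr_LR /= expr2.
(* Here [ip x p] equals the square norm of [p], so expanding the square norm of [x - p] leaves that
   of [x] minus that of [p]. *)
have := sqr_ge0 `|x - p|; rewrite sqr_normB xp -pE; lra.
Qed.

Lemma cvg_l2_coef (x : X) : cvgn (series (fun k => ip x (e k) ^+ 2)).
Proof.
apply: nondecreasing_is_cvgn.
  by apply: nondecreasing_series => n _ _; exact: sqr_ge0.
by exists (`|x| ^+ 2) => _ [n _ <-]; exact: bessel.
Qed.

(** By Pythagoras the square norm of a block is the same block of the series of squares, so the
    Cauchy property carries over; completeness concludes. *)
Lemma cvg_ortho_series (c : nat -> R) : cvgn (series (fun k => c k ^+ 2)) ->
  cvgn (series (fun k => c k *: e k)).
Proof.
move=> /cvg_cauchy/cauchy_seriesP c2.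
apply/cauchy_cvgP/cauchy_seriesP => r r0.
have := c2 _ (exprn_gt0 2 r0); apply: filterS => -[m n] /=.
rewrite -sqr_norm_sum_ortho ?iota_uniq// ger0_norm ?sqr_ge0//.
by rewrite ltr_pXn2r// ?nnegrE// ltW.
Qed.

Lemma ip_ortho_series (c : nat -> R) (s : X) (k : nat) :
  series (fun i => c i *: e i) @ \oo --> s -> ip s (e k) = c k.
Proof.
move=> cs.
have h := @cvg_comp _ _ _ _ _ _ _ _ cs (continuous_ip (e k) s).
apply: (cvg_unique _ h) => //.
(* The coefficient along [e k] is constant once the partial sum contains the index [k]. *)
apply: cvg_near_cst; exists k.+1 => // n /= kn.
by rewrite /series /= ip_sum_ortho ?iota_uniq// mem_index_iota kn.
Qed.

Lemma parseval_series (c : nat -> R) (s : X) :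
  series (fun i => c i *: e i) @ \oo --> s ->
  series (fun i => c i ^+ 2) @ \oo --> `|s| ^+ 2.
Proof.
move=> cs.
rewrite (_ : series _ = fun n => `|series (fun i => c i *: e i) n| ^+ 2); last first.
  by apply/funext => n; rewrite /series /= sqr_norm_sum_ortho ?iota_uniq.
rewrite expr2; under eq_fun do rewrite expr2.
by apply: cvgM; exact: cvg_norm.
Qed.

Lemma cvg_coef_series (x : X) :
  cvgn (series (fun k => ip x (e k) *: e k)).
Proof. exact/cvg_ortho_series/cvg_l2_coef. Qed.

End Hilbert.

(** * Singular value expansion, pseudo-inverse and reconstruction error *)

Section SVD.
Variables (R : realType) (X Y : completeNormedModType R).
Variables (ipX : {dot X for idfun}) (ipY : {dot Y for idfun}).
Hypotheses (hX : induces_norm ipX) (hY : induces_norm ipY).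
Variables (A : {linear X -> Y}) (sigma : nat -> R) (u : nat -> X) (v : nat -> Y).
Hypothesis A_svd : singular_system ipX ipY A sigma u v.

Let u_ortho (i j : nat) : ipX (u i) (u j) = (i == j)%:R.
Proof. by have [_ [h _] _ _] := A_svd; exact: h. Qed.

Let v_ortho (i j : nat) : ipY (v i) (v j) = (i == j)%:R.
Proof. by have [_ _ [h _] _] := A_svd; exact: h. Qed.

Let A_series (x : X) :
  series (fun n => (sigma n * ipX x (u n)) *: v n) @ \oo --> A x.
Proof. by have [_ _ _] := A_svd. Qed.

Lemma svd_coef (x : X) (n : nat) : ipY (A x) (v n) = sigma n * ipX x (u n).
Proof. exact: (ip_ortho_series _ _ _ hY _ v_ortho _ _ _ (A_series x)). Qed.

(** Forward, the positive [sigma n] cancel; backward, the expansion of [A x] involves [x] only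
    through these coefficients. *)
Lemma svd_eq_imageP (x z : X) :
  A x = A z <-> forall n, ipX x (u n) = ipX z (u n).
Proof.
split=> [Axz n|xz].
  have [s0 _ _ _] := A_svd.
  by apply: (mulfI (lt0r_neq0 (s0 n))); rewrite -!svd_coef Axz.
apply: (cvg_unique _ (A_series x)) => //.
have -> : (fun n => (sigma n * ipX x (u n)) *: v n) =
          (fun n => (sigma n * ipX z (u n)) *: v n).
  by apply/funext => n; rewrite xz.
exact: A_series.
Qed.

Lemma least_squares_image (x : X) :
  least_squares A (A x) = [set z | A z = A x].
Proof.
apply/seteqP; split => z /=; last by move=> zx y; rewrite zx subrr normr0.
by move/(_ x); rewrite subrr normr0 normr_le0 subr_eq0 => /eqP.
Qed.

(** The sum [p] of the series has the coefficients of [x], hence the same image. Any other solution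
    [z] satisfies [ipX z p = |p|^2], so [|z - p|^2 = |z|^2 - |p|^2]: this gives both minimality and
    uniqueness of [p]. *)
Lemma moore_penrose_svd (x : X) :
  series (fun n => ipX x (u n) *: u n) @ \oo --> moore_penrose A (A x).
Proof.
set p := limn (series (fun n => ipX x (u n) *: u n)).
have xp : series (fun n => ipX x (u n) *: u n) @ \oo --> p.
  exact: (cvg_coef_series _ _ _ hX).
have pn n : ipX p (u n) = ipX x (u n) by exact: (ip_ortho_series _ _ _ hX _ u_ortho _ _ _ xp).
have np := parseval_series _ _ _ hX _ u_ortho _ _ xp.
have zp z : (forall n, ipX z (u n) = ipX x (u n)) -> ipX z p = `|p| ^+ 2.
  move=> zx; rewrite ip_sym.
  have h := @cvg_comp _ _ _ _ _ _ _ _ xp (continuous_ip _ _ _ hX z p).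
  apply: (cvg_unique _ h) => //.
  apply: cvg_trans np; apply: near_eq_cvg; apply: nearW => n /=.
  rewrite /series /= linear_sumlz; apply: eq_bigr => i _.
  by rewrite linearZl_LR /= (ip_sym _ _ _ (u i)) zx expr2.
suff -> : moore_penrose A (A x) = p by [].
apply: xget_unique => [|z]; rewrite least_squares_image /=.
  split=> [|z Azx]; first exact/svd_eq_imageP.
  have {}/zp zx : forall n, ipX z (u n) = ipX x (u n) by exact/svd_eq_imageP.
  rewrite -(@ler_pXn2r _ 2)// ?nnegrE//.
  by have := sqr_ge0 `|z - p|; rewrite (sqr_normB _ _ _ hX) zx; lra.
move=> [/svd_eq_imageP/zp zx /(_ p)].
rewrite svd_eq_imageP => /(_ pn) zp'.
apply/eqP; rewrite -subr_eq0 -normr_eq0 -sqrf_eq0; apply/eqP/le_anti.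
rewrite sqr_ge0 andbT (sqr_normB _ _ _ hX) zx.
by move: zp'; rewrite -(@ler_pXn2r _ 2)// ?nnegrE//; lra.
Qed.

(* If the right-hand side is finite, the coefficients of the error are
   square-summable, so the series defining the reconstruction converges;
   otherwise there is nothing to prove. *)
Lemma sqr_norm_error_le (x : X) (g y : nat -> R) :
  ((`|moore_penrose A (A x) - filter_reconstruct u g y| ^+ 2)%:E
   <= \sum_(0 <= n <oo) ((ipX x (u n) - g n * y n) ^+ 2)%:E)%E.
Proof.
set d := fun n => ipX x (u n) - g n * y n.
case: (ltP (\sum_(0 <= n <oo) (d n ^+ 2)%:E)%E +oo%E); last first.
  by rewrite leye_eq => /eqP ->; rewrite leey.
move=> /(nnseries_is_cvg (fun n => sqr_ge0 (d n))) d2.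
have du : series (fun n => d n *: u n) @ \oo --> limn (series (fun n => d n *: u n)).
  exact: (cvg_ortho_series _ _ _ hX).
have px := moore_penrose_svd x.
(* The reconstruction series is the difference of two convergent series, so its [lim] is a genuine
   limit. *)
have gy : filter_reconstruct u g y =
    moore_penrose A (A x) - limn (series (fun n => d n *: u n)).
  apply: cvg_lim => //; have := cvgB (FF := eventually_filter) px du.
  apply: cvg_trans; apply: near_eq_cvg; apply: nearW => n /=.
  rewrite /series /= !fctE -sumrB; apply: eq_bigr => i _.
  by rewrite -scalerBl /d subKr.
rewrite gy subKr -(cvg_lim _ (parseval_series _ _ _ hX _ u_ortho _ _ du))//.
rewrite -EFin_lim// (_ : EFin \o _ = fun n => \sum_(0 <= i < n) (d i ^+ 2)%:E)%E//.
by apply/funext => n; rewrite /= sumEFin.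
Qed.

End SVD.

(** * Integration on the product space and measurability of coefficients *)

(* [f] need not be measurable: the integral of a nonnegative function is a
   supremum over simple functions below it. *)
Lemma ge0_le_lower_integral d (T : measurableType d) (R : realType)
    (m : {measure set T -> \bar R}) (f g : T -> \bar R) :
  (forall x, 0 <= f x)%E -> (forall x, f x <= g x)%E ->
  (\int[m]_x f x <= \int[m]_x g x)%E.
Proof.
move=> f0 fg; rewrite !ge0_integralTE//; last first.
  by move=> x; exact: le_trans (fg x).
apply: ereal_sup_le => _ [h /= hf <-]; exists h => //= x.
exact: le_trans (fg x).
Qed.

Lemma integral_prod_fst d1 d2 (T1 : measurableType d1) (T2 : measurableType d2)
    (R : realType) (P : probability T1 R) (Q : probability T2 R)
    (f : T1 -> \bar R) :
  measurable_fun setT f -> (forall x, 0 <= f x)%E ->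
  (\int[P \x Q]_w f w.1 = \int[P]_x f x)%E.
Proof.
move=> mf f0; rewrite fubini_tonelli1//=; last first.
  exact: measurableT_comp mf measurable_fst.
apply: eq_integral => x _; rewrite /fubini_F /=.
by rewrite integral_cst// [X in (_ * X)%E]probability_setT mule1.
Qed.

Lemma integral_prod_snd d1 d2 (T1 : measurableType d1) (T2 : measurableType d2)
    (R : realType) (P : probability T1 R) (Q : probability T2 R)
    (f : T2 -> \bar R) :
  measurable_fun setT f -> (forall x, 0 <= f x)%E ->
  (\int[P \x Q]_w f w.2 = \int[Q]_x f x)%E.
Proof.
move=> mf f0; rewrite fubini_tonelli2//=; last first.
  exact: measurableT_comp mf measurable_snd.
apply: eq_integral => x _; rewrite /fubini_G /=.
by rewrite integral_cst// [X in (_ * X)%E]probability_setT mule1.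
Qed.

(** Open intervals generate the Borel sets of the line, and their preimages under a continuous map
    are open. *)
Lemma measurable_ip (R : realType) (X : completeNormedModType R)
    (ip : {dot X for idfun}) (hX : induces_norm ip) (y : X) :
  measurable_fun setT (fun x : borel_space X => ip x y).
Proof.
apply: (measurability _ (RGenOpens.measurableE R)).
move=> _ [_ [a [b ->] <-]]; rewrite setTI; apply: sub_sigma_algebra.
have /continuousP cip := continuous_ip _ _ _ hX y.
exact/cip/interval_open.
Qed.

Lemma measurable_coef (R : realType) (n : nat) :
  measurable_fun setT (@coef R n).
Proof.
move=> _ B mB; rewrite setTI; apply: sub_sigma_algebra.
by exists n, B.
Qed.

(** * Scalar estimates for the MSE filter *)

Lemma powR_weighted_le_add (R : realType) (a b s : R) :
  0 < a -> 0 < b -> 0 <= s <= 1 -> a `^ s * b `^ (1 - s) <= a + b.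
Proof.
move=> a0 b0 /andP[s0 s1]; have ab0 : 0 < a + b by exact: addr_gt0.
(* Splitting [a + b] with the same exponents allows a comparison factor by factor. *)
have -> : a + b = (a + b) `^ s * (a + b) `^ (1 - s).
  by rewrite -powRD ?subrKC ?powRr1 ?ltW//; apply/implyP => _; rewrite gt_eqF.
apply: ler_pM; rewrite ?powR_ge0//.
  by apply: ge0_ler_powR; rewrite ?nnegrE ?(ltW a0) ?(ltW ab0)// lerDl ltW.
apply: ge0_ler_powR; rewrite ?subr_ge0 ?nnegrE ?(ltW b0) ?(ltW ab0)//.
by rewrite lerDr ltW.
Qed.

Lemma mse_filter_error (R : realType) (s P D : R) (g := s * P / (P * s ^+ 2 + D)) :
  0 < s -> 0 <= P -> 0 <= D ->
  (1 - g * s) ^+ 2 * P + g ^+ 2 * D = P * D / (P * s ^+ 2 + D).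
Proof.
move=> s0 P0 D0; rewrite /g.
have Ps0 : 0 <= P * s ^+ 2 by rewrite mulr_ge0// sqr_ge0.
(* For [P = 0] the filter coefficient is 0, also in the case 0 / 0; otherwise the denominator is
   positive. *)
have [P0'|PN0] := eqVneq P 0.
  by rewrite P0' !(mulr0, mul0r, addr0, add0r, expr0n).
have : P * s ^+ 2 + D != 0.
  rewrite gt_eqF// ltr_wpDr// mulr_gt0// ?exprn_gt0//.
  by rewrite lt_neqAle eq_sym PN0.
by move=> ?; field.
Qed.

Lemma mse_filter_rate (R : realType) (s P D mu beta : R)
    (theta := 2 * mu / (1 + 2 * mu)) :
  0 < s -> 0 <= mu -> 0 <= beta -> 0 <= D -> P = s `^ (4 * mu) * beta ->
  P * D / (P * s ^+ 2 + D) <= beta `^ (1 / (1 + 2 * mu)) * D `^ theta.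
Proof.
move=> s0 mu0 b0 D0 PE.
(* If [beta] or [D] is 0 the left side vanishes; the power identities below use positive bases. *)
have [bE|bN0] := eqVneq beta 0.
  by rewrite PE bE !(mulr0, mul0r) mulr_ge0// powR_ge0.
have [->|DN0] := eqVneq D 0.
  by rewrite mulr0 mul0r mulr_ge0// powR_ge0.
have {bN0 b0} b0 : 0 < beta by rewrite lt_neqAle eq_sym bN0.
have {DN0 D0} D0 : 0 < D by rewrite lt_neqAle eq_sym DN0.
have P0 : 0 < P by rewrite PE mulr_gt0// powR_gt0.
have Ps0 : 0 < P * s ^+ 2 by rewrite mulr_gt0// exprn_gt0.
have m0 : 1 + 2 * mu != 0 by rewrite gt_eqF//; lra.
have thetaC : 1 / (1 + 2 * mu) = 1 - theta by rewrite /theta; field.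
have t0 : 0 <= theta by rewrite /theta divr_ge0//; lra.
have t1 : theta <= 1 by rewrite -subr_ge0 -thetaC divr_ge0//; lra.
(* This identity fixes [theta]: it makes the power of [s] in [P ^ (1 - theta)] equal to the one in
   [(P * s ^ 2) ^ theta], so the final bound is free of [s]. *)
have st : 4 * mu * (1 - theta) = 2 * theta by rewrite /theta; field.
rewrite thetaC ler_pdivrMr ?addr_gt0//.
apply: (@le_trans _ _ (beta `^ (1 - theta) * D `^ theta *
    ((P * s ^+ 2) `^ theta * D `^ (1 - theta)))); last first.
  rewrite ler_wpM2l ?mulr_ge0 ?powR_ge0//.
  by rewrite powR_weighted_le_add// t0.
have powR_split x : 0 < x -> x `^ theta * x `^ (1 - theta) = x.
  move=> x0; rewrite -powRD ?subrKC ?powRr1 ?ltW//.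
  by apply/implyP => _; rewrite gt_eqF.
have P1 : P `^ (1 - theta) = (s ^+ 2) `^ theta * beta `^ (1 - theta).
  by rewrite PE powRM ?powR_ge0 ?ltW// -powRrM st powRrM powR_mulrn ?ltW.
rewrite (powRM _ (ltW P0) (sqr_ge0 s)) -{1}(powR_split P)// -{1}(powR_split D)// P1.
by rewrite le_eqVlt; apply/orP; left; apply/eqP; ring.
Qed.

(** * Bounding the mean square error by a series of variances *)

Lemma mse_le_series (R : realType) (X Y : completeNormedModType R)
    (ipX : {dot X for idfun}) (ipY : {dot Y for idfun})
    (hX : induces_norm ipX) (hY : induces_norm ipY)
    (A : {linear X -> Y}) (sigma : nat -> R) (u : nat -> X) (v : nat -> Y)
    (A_svd : singular_system ipX ipY A sigma u v)
    (Px : probability (borel_space X) R) (Pe : probability (noise_space R) R)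
    (g := mse_filter ipX sigma u Px Pe) :
  (mse ipX ipY A sigma u v Px Pe <=
   \sum_(0 <= n <oo) ((2 * (1 - g n * sigma n) ^+ 2)%:E * data_var ipX u Px n
                      + (2 * g n ^+ 2)%:E * noise_var Pe n))%E.
Proof.
pose F1 n (x : borel_space X) := ((ipX x (u n)) ^+ 2)%:E.
pose F2 n (e : noise_space R) := ((coef n e) ^+ 2)%:E.
have mF1 n : measurable_fun setT (F1 n).
  by apply/measurable_EFinP; apply: measurable_funX; exact: measurable_ip.
have mF2 n : measurable_fun setT (F2 n).
  by apply/measurable_EFinP; apply: measurable_funX; exact: measurable_coef.
have F10 n x : (0 <= F1 n x)%E by rewrite lee_fin sqr_ge0.
have F20 n e : (0 <= F2 n e)%E by rewrite lee_fin sqr_ge0.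
pose G n (w : borel_space X * noise_space R) :=
  ((2 * (1 - g n * sigma n) ^+ 2)%:E * F1 n w.1 + (2 * g n ^+ 2)%:E * F2 n w.2)%E.
have c0 (r : R) : 0 <= 2 * r ^+ 2 by rewrite mulr_ge0// sqr_ge0.
have c0E (r : R) : (0 <= (2 * r ^+ 2)%:E)%E by rewrite lee_fin.
have mF1' n : measurable_fun setT (fun w : borel_space X * noise_space R => F1 n w.1).
  exact: measurableT_comp (mF1 n) measurable_fst.
have mF2' n : measurable_fun setT (fun w : borel_space X * noise_space R => F2 n w.2).
  exact: measurableT_comp (mF2 n) measurable_snd.
have m1 n : measurable_fun setT (fun w : borel_space X * noise_space R =>
    (2 * (1 - g n * sigma n) ^+ 2)%:E * F1 n w.1)%E by exact: measurable_funeM.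
have m2 n : measurable_fun setT (fun w : borel_space X * noise_space R =>
    (2 * g n ^+ 2)%:E * F2 n w.2)%E by exact: measurable_funeM.
have mG n : measurable_fun setT (G n) by exact: emeasurable_funD.
have G0 n w : (0 <= G n w)%E by rewrite adde_ge0// mule_ge0.
apply: (@le_trans _ _ (\int[(Px \x Pe)%E]_w \sum_(0 <= n <oo) G n w)%E).
  (* Only the dominating series is known to be measurable here, hence the comparison of lower
     integrals. *)
  apply: ge0_le_lower_integral => [w|w]; first by rewrite lee_fin sqr_ge0.
  apply: le_trans (sqr_norm_error_le _ _ _ _ _ hX hY _ _ _ _ A_svd _ _ _) _.
  apply: lee_nneseries => n _; first by rewrite lee_fin sqr_ge0.
  rewrite (svd_coef _ _ _ _ _ hY _ _ _ _ A_svd) /G /F1 /F2.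
  rewrite -!EFinM -EFinD lee_fin -subr_ge0 -/(g n).
  set a := ipX _ _; set b := coef _ _.
  (* This is [2 p^2 + 2 q^2 - (p - q)^2 = (p + q)^2], with [p = (1 - g n * sigma n) * a] and
     [q = g n * b]. *)
  rewrite [leRHS](_ : _ = ((1 - g n * sigma n) * a + g n * b) ^+ 2) ?sqr_ge0//.
  by ring.
rewrite integral_nneseries//; apply: lee_nneseries => n _.
  by move=> _; apply: integral_ge0.
rewrite /data_var /noise_var unlock /G ge0_integralD//; last 2 first.
- by move=> w _; rewrite mule_ge0.
- by move=> w _; rewrite mule_ge0.
rewrite !ge0_integralZl_EFin// (integral_prod_fst _ _ _ _ _ Px Pe (F1 n))//.
by rewrite (integral_prod_snd _ _ _ _ _ Px Pe (F2 n)).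
Qed.

(** * The convergence rate, uniformly over the noise family *)

Theorem theorem3 (R : realType) (X Y : completeNormedModType R)
    (ipX : {dot X for idfun}) (ipY : {dot Y for idfun})
    (hX : induces_norm ipX) (hY : induces_norm ipY)
    (A : {linear X -> Y})
    (A_compact : compact_operator A) (A_inf : infinite_dim_range A)
    (sigma : nat -> R) (u : nat -> X) (v : nat -> Y)
    (A_svd : singular_system ipX ipY A sigma u v)
    (Px : probability (borel_space X) R)
    (Px_moment : ('E_Px[fun x => (`|x : X| ^+ 2)%R] < +oo)%E)
    (Psi : set (probability (noise_space R) R))
    (Psi_noise : forall Pe, Psi Pe -> centered_square_integrable Pe)
    (mu c : R) (mu_ge0 : 0 <= mu)
    (beta : nat -> R) (beta_ge0 : forall n, 0 <= beta n)
    (data_source : forall n,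
       data_var ipX u Px n = (sigma n `^ (4 * mu) * beta n)%:E)
    (noise_source : forall Pe, Psi Pe ->
       exists gamma : nat -> R,
         [/\ forall n, 0 <= gamma n,
             forall n, noise_var Pe n = (noise_level Pe ^+ 2 * (gamma n)%:E)%E &
             (\sum_(0 <= n <oo)
                (beta n `^ (1 / (1 + 2 * mu))
                 * gamma n `^ (2 * mu / (1 + 2 * mu)))%:E <= c%:E)%E]) :
  exists C' : R, forall delta : R, 0 < delta ->
    (nonneg_sup
       [set mse ipX ipY A sigma u v Px Pe | Pe in
             [set Pe | Psi Pe /\ (noise_level Pe <= delta%:E)%E]]
     <= (C' * delta `^ (2 * (2 * mu / (1 + 2 * mu))))%:E)%E.
Proof.
set theta := 2 * mu / (1 + 2 * mu).
(* The 2 comes from splitting the square. The absolute value keeps the constant nonnegative even if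
   no noise distribution is admissible, when the supremum is 0 and [c] may be negative. *)
exists (2 * `|c|) => delta d0; rewrite /nonneg_sup; case: ifPn => _.
  by rewrite lee_fin mulr_ge0// powR_ge0.
apply: ge_ereal_sup => _ [Pe /= [PsiPe lvl] <-].
have [gamma [gamma0 noiseE sum_le]] := noise_source Pe PsiPe.
have [sigma0 _ _ _] := A_svd.
have theta0 : 0 <= theta by rewrite divr_ge0//; lra.
have [l lE] : exists l, noise_level Pe = l%:E.
  exists (fine (noise_level Pe)); rewrite fineK// ge0_fin_numE ?sqrte_ge0//.
  exact: le_lt_trans lvl (ltry _).
have l0 : 0 <= l by rewrite -lee_fin -lE sqrte_ge0.
have ld : l <= delta by rewrite -lee_fin -lE.
have {}noiseE n : noise_var Pe n = (l ^+ 2 * gamma n)%:E.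
  by rewrite noiseE lE -EFin_expe -EFinM.
apply: (le_trans (mse_le_series _ _ _ _ _ hX hY _ _ _ _ A_svd _ _)).
pose b n := beta n `^ (1 / (1 + 2 * mu)) * gamma n `^ theta.
have b0 n : 0 <= b n by rewrite mulr_ge0// powR_ge0.
apply: (@le_trans _ _ (\sum_(0 <= n <oo) (2 * delta `^ (2 * theta))%:E * (b n)%:E)%E).
  apply: lee_nneseries => n _.
    move=> _; rewrite data_source noiseE -!EFinM -EFinD lee_fin.
    apply: addr_ge0; apply: mulr_ge0; apply: mulr_ge0 => //;
      by rewrite ?powR_ge0 ?sqr_ge0.
  rewrite /mse_filter data_source noiseE -!EFinM -EFinD lee_fin /=.
  set P := _ `^ _ * _; set D := _ * gamma n.
  have P0 : 0 <= P by rewrite mulr_ge0// powR_ge0.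
  have D0 : 0 <= D by rewrite mulr_ge0// sqr_ge0.
  rewrite -(mulrA 2) -(mulrA 2 _ D) -mulrDr -[leRHS]mulrA ler_wpM2l//.
  rewrite (mse_filter_error _ _ _ _ (sigma0 n) P0 D0).
  apply: (le_trans (mse_filter_rate _ _ _ _ _ _ (sigma0 n) mu_ge0 (beta_ge0 n) D0 erefl)).
  rewrite -/theta /b mulrCA ler_wpM2l ?powR_ge0//.
  rewrite /D powRM ?sqr_ge0// ler_wpM2r ?powR_ge0//.
  (* Writing [delta ^ (2 * theta)] as [(delta ^ 2) ^ theta] leaves [l <= delta] and monotonicity of
     the power [theta >= 0]. *)
  rewrite powRrM powR_mulrn ?(ltW d0)//.
  apply: ge0_ler_powR; rewrite ?nnegrE ?sqr_ge0//.
  by rewrite ler_pXn2r// ?nnegrE// ltW.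
rewrite nneseriesZl; last by move=> n _; rewrite lee_fin.
apply: (@le_trans _ _ ((2 * delta `^ (2 * theta))%:E * c%:E)%E).
  by apply: lee_wpmul2l; rewrite ?lee_fin ?mulr_ge0 ?powR_ge0.
rewrite -EFinM lee_fin mulrAC ler_wpM2r ?powR_ge0//.
by rewrite ler_wpM2l// ler_norm.
Qed.
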